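(* There exists a $4$-GDD of type $5^8 14^1 20^1$. There also exist $4$-GDDs of each of the following types: $2^{14} 5^5$, $2^4 5^9$, $2^{18} 5^4$, $2^8 5^8$, $2^{17} 5^5$, $2^{11} 5^8$, $2^{20} 5^5$, $2^{14} 5^8$, $2^{26} 5^5$, $2^{16} 5^9$, $2^6 5^{13}$, $2^{19} 5^9$.
   Context: A $4$-GDD is a triple $(X,\mathcal{G},\mathcal{B})$ where $X$ is a finite point set, $\mathcal{G}$ a partition of $X$ into groups, and $\mathcal{B}$ a collection of $4$-element subsets (blocks) such that no block meets a group in more than one point and any two points from distinct groups lie in exactly one common block. The type is the multiset of group sizes in exponential notation: $t_1^{u_1}\cdots t_m^{u_m}$ means $u_i$ groups of size $t_i$. *)

(* Defs.v *)
From mathcomp Require Import all_boot.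

Set Implicit Arguments.
Unset Strict Implicit.
Unset Printing Implicit Defensive.

(* [B] is a set rather than a multiset of blocks: a repeated block of four
   points from distinct groups would cover its pairs of points twice. *)
Record is_4GDD (X : finType) (G B : {set {set X}}) : Prop := Is4GDD {
  groups_partition : partition G [set: X];
  block_size : forall b : {set X}, b \in B -> #|b| = 4;
  block_group : forall b g : {set X}, b \in B -> g \in G -> #|b :&: g| <= 1;
  pair_block : forall (x y : X) (g h : {set X}), g \in G -> h \in G ->
    g != h -> x \in g -> y \in h ->
    exists! b : {set X}, [/\ b \in B, x \in b & y \in b]
}.

(* The type t_1^u_1 ... t_m^u_m is encoded as the list of the pairs
   (t_i, u_i); [tally_seq] repeats each t_i u_i times. *)
Definition has_group_type (X : finType) (G : {set {set X}})
    (t : seq (nat * nat)) : Prop :=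
  perm_eq [seq #|g| | g : {set X} in G] (tally_seq t).

Definition exists_4GDD_of_type (t : seq (nat * nat)) : Prop :=
  exists (X : finType) (G B : {set {set X}}),
    is_4GDD G B /\ has_group_type G t.

(* Main.v *)
(* Each of the designs is given explicitly: a permutation group on the points,
   preserving the partition into groups, together with representatives of its
   orbits of blocks.  These were found by computer as solutions of an exact
   cover problem: for a prescribed group, the orbits of pairs of points from
   distinct groups have to be covered by orbits of 4-subsets (the
   Kramer-Mesner method).  Checking that a list of blocks is a design amounts to
   comparing, for each point x, the points other than x of the blocks through x
   with the points outside of the group of x. *)

Require Import Defs.
From mathcomp Require Import all_boot.

Set Implicit Arguments.
Unset Strict Implicit.
Unset Printing Implicit Defensive.

(** * Lists whose concatenation is duplicate-free *)

(** Different members of [s] have disjoint images, or the concatenation would repeat an entry. With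
    [f] the identity, a point determines its group; with [f := rem x], a second point determines the
    block through [x]. *)
Lemma uniq_flatten_map_inj (S T : eqType) (f : S -> seq T) (s : seq S) a b y :
  uniq (flatten (map f s)) -> a \in s -> b \in s -> y \in f a -> y \in f b ->
  a = b.
Proof.
elim: s => //= c s IHs; rewrite cat_uniq => /and3P[_ /hasPn dis_c uniq_s].
have notin_c d : d \in s -> y \in f d -> y \notin f c.
  by move=> ds yd; apply: dis_c; apply/flattenP; exists (f d); rewrite ?map_f.
rewrite !inE => /predU1P[->|sa] /predU1P[->|sb] // ya yb.
- by rewrite (negPf (notin_c b sb yb)) in ya.
- by rewrite (negPf (notin_c a sa ya)) in yb.
- exact: IHs.
Qed.

(** A repeated nonempty list would repeat its entries in the concatenation. Repeated empty lists
    would go unnoticed, hence the first hypothesis. *)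
Lemma uniq_flatten_uniq (T : eqType) (s : seq (seq T)) :
  [::] \notin s -> uniq (flatten s) -> uniq s.
Proof.
elim: s => //= b s IHs; rewrite inE negb_or cat_uniq => /andP[nz_b nz_s].
case/and3P=> _ /hasPn dis_b uniq_s; rewrite IHs // andbT.
apply: contraNN nz_b => sb; case: b => [|x b] // in sb dis_b *.
have /dis_b : x \in flatten s.
  by apply/flattenP; exists (x :: b); rewrite ?mem_head.
by rewrite /= mem_head.
Qed.

(** * Point sets and designs encoded by lists of numbers *)

Section ListedSets.

Variable v : nat.

Definition set_of_list (b : seq nat) : {set 'I_v} :=
  [set x : 'I_v | val x \in b].

Lemma card_set_of_list b :
  uniq b -> all (ltn^~ v) b -> #|set_of_list b| = size b.
Proof.
move=> uniq_b /allP lt_b; rewrite cardE -(size_map val); apply: perm_size.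
apply: uniq_perm => // [|y].
  by rewrite map_inj_uniq ?enum_uniq //; exact: val_inj.
apply/mapP/idP => [[x]|yb]; first by rewrite mem_enum inE => xb ->.
by exists (Ordinal (lt_b y yb)); rewrite // mem_enum inE.
Qed.

End ListedSets.

(* [sort] is cheaper than the quadratic [perm_eq]: this test is evaluated on
   lists of several hundred blocks. *)
Definition gdd_check (sizes : seq nat) (bs : seq (seq nat)) : bool :=
  let pts := iota 0 (sumn sizes) in
  [&& 0 \notin sizes,
      all (fun b => [&& size b == 4, uniq b & all (ltn^~ (sumn sizes)) b]) bs &
      all (fun g => let others := [seq y <- pts | y \notin g] in
        all (fun x => sort leq (flatten [seq rem x b | b <- bs & x \in b])
                      == others) g)
        (reshape sizes pts)].

(** The groups are consecutive intervals of [0, ..., v - 1]. For [x] in a group [g], the one list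
    equality tested gives three facts: blocks through [x] contain no other point of [g], they reach
    every point outside [g], and each only once because the right-hand list has no repetition. *)
Lemma exists_4GDD_of_check (t : seq (nat * nat)) (bs : seq (seq nat)) :
  gdd_check (tally_seq t) bs -> exists_4GDD_of_type t.
Proof.
rewrite /gdd_check; set s := tally_seq t; set v := sumn s.
case/and3P=> nz_s /allP bsP /allP pairsP.
set gs := reshape s (iota 0 v) in pairsP.
have shape_gs : shape gs = s by rewrite reshapeKl ?size_iota.
have flat_gs : flatten gs = iota 0 v by rewrite reshapeKr ?size_iota.
have uniq_gs : uniq (flatten gs) by rewrite flat_gs iota_uniq.
have nil_gs : [::] \notin gs.
  by apply: contra nz_s => gs0; rewrite -shape_gs; apply/mapP; exists [::].
have gs_lt g y : g \in gs -> y \in g -> y < v.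
  move=> gsg yg; have: y \in flatten gs by apply/flattenP; exists g.
  by rewrite flat_gs mem_iota.
have gs_inj a b y : a \in gs -> b \in gs -> y \in a -> y \in b -> a = b.
  by apply: uniq_flatten_map_inj; rewrite map_id.
(* A point of the nonempty list [a] lies in both sets, hence in both lists, and determines its list.
   This keeps groups from being merged, so that the multiplicities in the type are right. *)
have set_inj : {in gs &, injective (@set_of_list v)}.
  move=> [|y a] b gsa gsb eq_ab; first by rewrite gsa in nil_gs.
  have ya : y \in y :: a by rewrite inE eqxx.
  apply: (gs_inj _ _ y) => //.
  have := in_set (fun x : 'I_v => val x \in b) (Ordinal (gs_lt _ _ gsa ya)).
  by rewrite -/(set_of_list v b) -eq_ab inE /= ya.
have pairP g x : g \in gs -> x \in g ->
    perm_eq (flatten [seq rem x b | b <- bs & x \in b])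
            [seq y <- iota 0 v | y \notin g].
  move=> gsg xg; have /allP/(_ x xg)/eqP<- := pairsP g gsg.
  by rewrite perm_sym perm_sort.
pose G := [set:: [seq set_of_list v g | g <- gs]].
pose B := [set:: [seq set_of_list v b | b <- bs]].
have GP g : reflect (exists2 h, h \in gs & g = set_of_list v h) (g \in G).
  by rewrite inE; exact: mapP.
have BP b : reflect (exists2 h, h \in bs & b = set_of_list v h) (b \in B).
  by rewrite inE; exact: mapP.
exists 'I_v, G, B; split; last first.
  rewrite /has_group_type -/s -shape_gs.
  have -> : shape gs =
      [seq #|g : {set 'I_v}| | g <- [seq set_of_list v g | g <- gs]].
    rewrite -map_comp; apply/eq_in_map => g gsg /=; rewrite card_set_of_list //.
      (* Each group is a piece of a duplicate-free concatenation, hence duplicate-free. *)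
      elim: (gs) gsg uniq_gs => //= h r IHr.
      by rewrite inE cat_uniq => /predU1P[->|/IHr{}IHr] /and3P[].
    by apply/allP => y; exact: gs_lt.
  (* The enumeration of [G] and the list of group sets have the same members, each once, so their
     cardinalities agree with multiplicity. *)
  apply/perm_map/uniq_perm; first exact: enum_uniq.
    by rewrite map_inj_in_uniq // uniq_flatten_uniq.
  by move=> g; rewrite mem_enum inE.
split.
- apply/and3P; split.
  + rewrite eqEsubset subsetT; apply/subsetP => x _.
    have /flattenP[g gsg xg] : val x \in flatten gs.
      by rewrite flat_gs mem_iota ltn_ord.
    by apply/bigcupP; exists (set_of_list v g); rewrite ?inE ?map_f.
  + apply/trivIsetP => _ _ /GP[g gsg ->] /GP[h gsh ->]; apply: contraR.
    case/pred0Pn=> x; rewrite !inE => /andP[xg xh].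
    by rewrite (gs_inj g h (val x)).
  + apply/GP => -[[|y g] gsg]; first by rewrite gsg in nil_gs.
    have yg : y \in y :: g by rewrite inE eqxx.
    by move/setP/(_ (Ordinal (gs_lt _ _ gsg yg))); rewrite !inE /= eqxx.
- move=> _ /BP[b bsb ->]; have /and3P[/eqP sz_b ub lt_b] := bsP b bsb.
  by rewrite card_set_of_list.
- move=> _ _ /BP[b bsb ->] /GP[g gsg ->]; have /and3P[_ ub _] := bsP b bsb.
  apply/card_le1_eqP => x y; rewrite !inE => /andP[xb xg] /andP[yb yg].
  (* A second point [y] of [b] occurs in [rem x b], and the check at [x] places all such points
     outside [g]. *)
  apply/eqP; apply: contraLR yg => neq_xy.
  have: val y \in flatten [seq rem (val x) b | b <- bs & val x \in b].
    apply/flattenP; exists (rem (val x) b).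
      by rewrite map_f // mem_filter xb.
    by rewrite mem_rem_uniq // !inE yb andbT.
  by rewrite (perm_mem (pairP _ _ gsg xg)) mem_filter => /andP[].
- move=> x y _ _ /GP[g gsg ->] /GP[h gsh ->] neq_gh; rewrite !inE => xg yh.
  have pm := pairP _ _ gsg xg.
  have yg : val y \notin g.
    by apply: contraNN neq_gh => yg; rewrite (gs_inj g h (val y)).
  (* Existence: [y] is outside the group of [x], so it occurs in [rem x b] for some listed block [b]
     through [x]. *)
  have: val y \in flatten [seq rem (val x) b | b <- bs & val x \in b].
    by rewrite (perm_mem pm) mem_filter yg mem_iota ltn_ord.
  case/flattenP=> _ /mapP[b + ->]; rewrite mem_filter => /andP[xb bsb] yb.
  exists (set_of_list v b); split.
    by split; rewrite inE ?xb ?(mem_rem yb) ?map_f.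
  move=> _ [/BP[c bsc ->]]; rewrite !inE => xc yc; congr set_of_list.
  (* Uniqueness: [y] occurs in both [rem x b] and [rem x c], pieces of a duplicate-free
     concatenation. *)
  apply: (@uniq_flatten_map_inj _ _ (rem (val x))
    [seq b <- bs | val x \in b] _ _ (val y)).
  + by rewrite (perm_uniq pm) filter_uniq ?iota_uniq.
  + by rewrite mem_filter xb.
  + by rewrite mem_filter xc.
  + by [].
  + have /and3P[_ uc _] := bsP c bsc; rewrite mem_rem_uniq // !inE yc andbT.
    by apply: contraNneq yg => ->.
Qed.

(** * Development of base blocks under a permutation group *)

(** [next] fixes every number off its cycle, so for disjoint cycles this is their product, and fixed
    points need not be listed. *)
Definition permute (cs : seq (seq nat)) (x : nat) : nat := foldr next x cs.

(* Each generator is given as the pair of its order and its nontrivial cycles.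
   The powers of the generators, multiplied in sequence, exhaust the group, so
   its orbits of blocks are obtained one cyclic factor at a time. *)
Definition develop (gens : seq (nat * seq (seq nat))) (bs : seq (seq nat)) :
    seq (seq nat) :=
  let turn g bs' :=
    flatten [seq traject (map (permute g.2)) b g.1 | b <- bs'] in
  undup [seq sort leq b | b <- foldr turn bs gens].

(** * The thirteen designs *)

(** A cyclic group of order 20, regular on the points of each half of the eight groups of size 5 and
    on the group of size 20. The orbit of [[:: 0; 12; 21; 33]] has length 10, as the involution
    preserves this block; with 19 full orbits this makes 390 blocks. *)
Lemma exists_4GDD_5x8_14x1_20x1 :
  exists_4GDD_of_type [:: (5, 8); (14, 1); (20, 1)].
Proof.
apply: (exists_4GDD_of_check (bs := develop
  [::
    (20,
     [:: [:: 0; 5; 10; 15; 1; 6; 11; 16; 2; 7; 12; 17; 3; 8; 13; 18; 4; 9; 14;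
          19]; [:: 20; 25; 30; 35; 21; 26; 31; 36; 22; 27; 32; 37; 23; 28; 33;
          38; 24; 29; 34; 39]; [:: 40; 41; 42; 43; 44; 45; 46; 47; 48; 49];
         [:: 50; 51]; [:: 54; 55; 56; 57; 58; 59; 60; 61; 62; 63; 64; 65; 66; 
         67; 68; 69; 70; 71; 72; 73]])]
  [:: [:: 0; 5; 49; 69]; [:: 0; 6; 26; 66]; [:: 0; 7; 44; 60];
      [:: 0; 8; 24; 67]; [:: 0; 9; 50; 62]; [:: 0; 10; 27; 32];
      [:: 0; 11; 43; 70]; [:: 0; 12; 21; 33]; [:: 0; 23; 52; 59];
      [:: 0; 25; 41; 56]; [:: 0; 28; 46; 57]; [:: 0; 29; 53; 73];
      [:: 0; 30; 39; 72]; [:: 0; 31; 42; 55]; [:: 0; 34; 37; 63];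
      [:: 0; 38; 40; 58]; [:: 20; 26; 47; 59]; [:: 20; 27; 51; 66];
      [:: 20; 30; 41; 60]; [:: 20; 31; 44; 68]])).
by vm_compute.
Qed.

(** A dihedral group of order 8: the first generator inverts the second. *)
Lemma exists_4GDD_2x14_5x5 :
  exists_4GDD_of_type [:: (2, 14); (5, 5)].
Proof.
apply: (exists_4GDD_of_check (bs := develop
  [::
    (2,
     [:: [:: 0; 2]; [:: 1; 3]; [:: 4; 6]; [:: 5; 7]; [:: 8; 10]; [:: 9; 11];
         [:: 12; 14]; [:: 13; 15]; [:: 16; 17]; [:: 18; 20]; [:: 19; 21];
         [:: 22; 23]; [:: 26; 27]; [:: 28; 33]; [:: 29; 34]; [:: 30; 35];
         [:: 31; 36]; [:: 32; 37]; [:: 38; 43]; [:: 39; 44]; [:: 40; 45];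
         [:: 41; 46]; [:: 42; 47]; [:: 48; 49]; [:: 50; 51]]);
    (4,
     [:: [:: 0; 4; 8; 12]; [:: 1; 5; 9; 13]; [:: 2; 14; 10; 6];
         [:: 3; 15; 11; 7]; [:: 16; 18; 22; 21]; [:: 17; 19; 23; 20];
         [:: 24; 26; 25; 27]; [:: 28; 34; 38; 44]; [:: 29; 33; 39; 43];
         [:: 30; 35; 40; 45]; [:: 31; 36; 41; 46]; [:: 32; 37; 42; 47]])]
  [:: [:: 0; 2; 32; 37]; [:: 0; 3; 8; 11]; [:: 0; 4; 22; 40];
      [:: 0; 5; 28; 36]; [:: 0; 6; 30; 41]; [:: 0; 7; 29; 47];
      [:: 0; 9; 21; 48]; [:: 0; 10; 16; 23]; [:: 0; 13; 25; 42];
      [:: 0; 14; 45; 52]; [:: 0; 15; 44; 51]; [:: 0; 17; 24; 33];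
      [:: 0; 19; 27; 38]; [:: 0; 20; 39; 43]; [:: 0; 26; 31; 50];
      [:: 0; 34; 46; 49]; [:: 1; 3; 30; 35]; [:: 1; 5; 21; 25];
      [:: 1; 7; 41; 52]; [:: 1; 11; 33; 38]; [:: 1; 15; 16; 19];
      [:: 1; 17; 42; 51]; [:: 1; 20; 40; 46]; [:: 1; 23; 29; 36];
      [:: 1; 24; 34; 45]; [:: 1; 32; 39; 49]; [:: 16; 18; 31; 37];
      [:: 16; 20; 42; 52]; [:: 16; 22; 33; 43]; [:: 16; 26; 35; 49];
      [:: 16; 39; 45; 51]; [:: 24; 26; 36; 47]; [:: 24; 38; 43; 52];
      [:: 28; 35; 39; 47]; [:: 30; 37; 40; 47]; [:: 31; 36; 41; 46]])).
by vm_compute.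
Qed.

(** The symmetric group of degree 3, acting regularly on the first six groups of size 5 and
    naturally on the last three. *)
Lemma exists_4GDD_2x4_5x9 :
  exists_4GDD_of_type [:: (2, 4); (5, 9)].
Proof.
apply: (exists_4GDD_of_check (bs := develop
  [::
    (2,
     [:: [:: 2; 4]; [:: 3; 5]; [:: 6; 7]; [:: 8; 13]; [:: 9; 14]; [:: 10; 15];
         [:: 11; 16]; [:: 12; 17]; [:: 18; 23]; [:: 19; 24]; [:: 20; 25];
         [:: 21; 26]; [:: 22; 27]; [:: 28; 33]; [:: 29; 34]; [:: 30; 35];
         [:: 31; 36]; [:: 32; 37]; [:: 43; 48]; [:: 44; 49]; [:: 45; 50];
         [:: 46; 51]; [:: 47; 52]]);
    (3,
     [:: [:: 0; 2; 4]; [:: 1; 3; 5]; [:: 8; 18; 28]; [:: 9; 19; 29];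
         [:: 10; 20; 30]; [:: 11; 21; 31]; [:: 12; 22; 32]; [:: 13; 33; 23];
         [:: 14; 34; 24]; [:: 15; 35; 25]; [:: 16; 36; 26]; [:: 17; 37; 27];
         [:: 38; 43; 48]; [:: 39; 44; 49]; [:: 40; 45; 50]; [:: 41; 46; 51];
         [:: 42; 47; 52]])]
  [:: [:: 0; 2; 8; 33]; [:: 0; 3; 10; 23]; [:: 0; 6; 25; 43];
      [:: 0; 9; 22; 26]; [:: 0; 11; 16; 38]; [:: 0; 12; 32; 45];
      [:: 0; 19; 46; 52]; [:: 0; 29; 34; 40]; [:: 0; 30; 35; 42];
      [:: 0; 31; 36; 39]; [:: 0; 41; 44; 49]; [:: 1; 3; 17; 22];
      [:: 1; 6; 11; 51]; [:: 1; 8; 13; 42]; [:: 1; 9; 14; 40];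
      [:: 1; 10; 15; 39]; [:: 1; 18; 26; 52]; [:: 1; 19; 24; 41];
      [:: 1; 20; 29; 43]; [:: 1; 31; 37; 49]; [:: 1; 38; 45; 50];
      [:: 6; 8; 24; 40]; [:: 6; 9; 19; 29]; [:: 6; 10; 22; 44];
      [:: 6; 13; 37; 47]; [:: 6; 16; 26; 36]; [:: 8; 14; 44; 48];
      [:: 8; 15; 22; 34]; [:: 8; 16; 23; 31]; [:: 8; 17; 30; 43];
      [:: 8; 18; 39; 50]; [:: 8; 19; 27; 51]; [:: 8; 20; 37; 41];
      [:: 8; 21; 38; 46]; [:: 8; 26; 29; 35]; [:: 9; 15; 42; 44];
      [:: 9; 21; 32; 39]; [:: 9; 27; 31; 35]; [:: 9; 36; 38; 52];
      [:: 10; 16; 30; 50]; [:: 10; 21; 45; 52]; [:: 10; 35; 41; 46];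
      [:: 11; 32; 46; 50]; [:: 12; 17; 47; 52]; [:: 12; 37; 38; 43]])).
by vm_compute.
Qed.

(** The alternating group of degree 4, acting naturally on the four groups of size 5; the two
    involutions generate its Klein four-subgroup. *)
Lemma exists_4GDD_2x18_5x4 :
  exists_4GDD_of_type [:: (2, 18); (5, 4)].
Proof.
apply: (exists_4GDD_of_check (bs := develop
  [::
    (2,
     [:: [:: 0; 16]; [:: 1; 17]; [:: 2; 12]; [:: 3; 13]; [:: 4; 14];
         [:: 5; 15]; [:: 6; 22]; [:: 7; 23]; [:: 8; 18]; [:: 9; 19];
         [:: 10; 20]; [:: 11; 21]; [:: 24; 34]; [:: 25; 35]; [:: 28; 30];
         [:: 29; 31]; [:: 36; 48]; [:: 37; 46]; [:: 38; 47]; [:: 39; 49];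
         [:: 40; 50]; [:: 41; 53]; [:: 42; 51]; [:: 43; 52]; [:: 44; 54];
         [:: 45; 55]]);
    (2,
     [:: [:: 0; 6]; [:: 1; 7]; [:: 2; 10]; [:: 3; 11]; [:: 4; 8]; [:: 5; 9];
         [:: 12; 20]; [:: 13; 21]; [:: 14; 18]; [:: 15; 19]; [:: 16; 22];
         [:: 17; 23]; [:: 26; 32]; [:: 27; 33]; [:: 28; 30]; [:: 29; 31];
         [:: 36; 41]; [:: 37; 43]; [:: 38; 42]; [:: 39; 44]; [:: 40; 45];
         [:: 46; 52]; [:: 47; 51]; [:: 48; 53]; [:: 49; 54]; [:: 50; 55]]);
    (3,
     [:: [:: 0; 2; 4]; [:: 1; 3; 5]; [:: 6; 12; 18]; [:: 7; 13; 19];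
         [:: 8; 16; 20]; [:: 9; 17; 21]; [:: 10; 14; 22]; [:: 11; 15; 23];
         [:: 24; 26; 28]; [:: 25; 27; 29]; [:: 30; 34; 32]; [:: 31; 35; 33];
         [:: 36; 37; 38]; [:: 41; 46; 51]; [:: 42; 48; 52]; [:: 43; 47; 53];
         [:: 44; 49; 54]; [:: 45; 50; 55]])]
  [:: [:: 0; 2; 4; 40]; [:: 0; 3; 9; 38]; [:: 0; 5; 19; 22];
      [:: 0; 6; 47; 51]; [:: 0; 7; 35; 36]; [:: 0; 8; 28; 53];
      [:: 0; 10; 18; 49]; [:: 0; 11; 23; 30]; [:: 0; 13; 27; 46];
      [:: 0; 14; 25; 39]; [:: 0; 15; 26; 44]; [:: 0; 16; 45; 55];
      [:: 0; 17; 29; 37]; [:: 0; 21; 31; 41]; [:: 0; 24; 42; 48];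
      [:: 0; 32; 43; 50]; [:: 1; 3; 43; 55]; [:: 1; 11; 39; 45];
      [:: 1; 17; 27; 32]; [:: 1; 23; 38; 51]; [:: 1; 24; 47; 52];
      [:: 1; 29; 34; 49]; [:: 24; 26; 28; 40]; [:: 24; 27; 33; 34];
      [:: 25; 27; 45; 51]; [:: 36; 42; 46; 54]; [:: 36; 44; 49; 53]])).
by vm_compute.
Qed.

(** A cyclic group of order 8, permuting the groups of size 5 in one cycle. *)
Lemma exists_4GDD_2x8_5x8 :
  exists_4GDD_of_type [:: (2, 8); (5, 8)].
Proof.
apply: (exists_4GDD_of_check (bs := develop
  [::
    (8,
     [:: [:: 0; 2; 4; 6]; [:: 1; 3; 5; 7]; [:: 8; 10; 12; 14; 9; 11; 13; 15];
         [:: 16; 21; 26; 31; 36; 41; 46; 51];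
         [:: 17; 22; 27; 32; 37; 42; 47; 52];
         [:: 18; 23; 28; 33; 38; 43; 48; 53];
         [:: 19; 24; 29; 34; 39; 44; 49; 54];
         [:: 20; 25; 30; 35; 40; 45; 50; 55]])]
  [:: [:: 0; 2; 4; 6]; [:: 0; 3; 26; 46]; [:: 0; 5; 32; 52];
      [:: 0; 7; 24; 44]; [:: 0; 8; 33; 55]; [:: 0; 10; 16; 43];
      [:: 0; 12; 29; 38]; [:: 0; 14; 27; 42]; [:: 0; 17; 50; 51];
      [:: 0; 19; 21; 54]; [:: 0; 20; 45; 48]; [:: 1; 3; 5; 7];
      [:: 1; 8; 26; 31]; [:: 1; 10; 19; 48]; [:: 1; 12; 23; 44];
      [:: 1; 14; 38; 52]; [:: 1; 16; 30; 53]; [:: 1; 17; 45; 55];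
      [:: 1; 20; 34; 47]; [:: 8; 10; 35; 44]; [:: 8; 11; 42; 47];
      [:: 8; 12; 18; 46]; [:: 8; 16; 25; 29]; [:: 8; 20; 41; 49];
      [:: 8; 21; 32; 50]; [:: 8; 24; 40; 45]; [:: 16; 23; 39; 47];
      [:: 16; 26; 42; 50]; [:: 16; 31; 48; 52]; [:: 16; 34; 38; 44];
      [:: 17; 23; 28; 38]; [:: 17; 24; 27; 39]; [:: 17; 34; 40; 48];
      [:: 18; 25; 38; 45]])).
by vm_compute.
Qed.

(** A cyclic group of order 4, fixing one group of size 5 and permuting the other four in a
    cycle. *)
Lemma exists_4GDD_2x17_5x5 :
  exists_4GDD_of_type [:: (2, 17); (5, 5)].
Proof.
apply: (exists_4GDD_of_check (bs := develop
  [::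
    (4,
     [:: [:: 0; 1]; [:: 2; 4; 6; 8]; [:: 3; 5; 7; 9]; [:: 10; 12; 14; 16];
         [:: 11; 13; 15; 17]; [:: 18; 20; 22; 24]; [:: 19; 21; 23; 25];
         [:: 26; 28; 30; 32]; [:: 27; 29; 31; 33]; [:: 34; 39; 44; 49];
         [:: 35; 40; 45; 50]; [:: 36; 41; 46; 51]; [:: 37; 42; 47; 52];
         [:: 38; 43; 48; 53]; [:: 54; 55]])]
  [:: [:: 0; 2; 6; 57]; [:: 0; 3; 17; 31]; [:: 0; 4; 29; 53];
      [:: 0; 5; 24; 37]; [:: 0; 10; 22; 41]; [:: 0; 11; 15; 58];
      [:: 0; 12; 30; 48]; [:: 0; 19; 23; 55]; [:: 0; 21; 45; 49];
      [:: 0; 28; 34; 40]; [:: 0; 36; 46; 54]; [:: 0; 42; 52; 56];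
      [:: 2; 4; 14; 39]; [:: 2; 5; 28; 35]; [:: 2; 7; 19; 25];
      [:: 2; 9; 51; 58]; [:: 2; 10; 45; 50]; [:: 2; 11; 41; 44];
      [:: 2; 13; 30; 54]; [:: 2; 15; 18; 20]; [:: 2; 16; 37; 43];
      [:: 2; 17; 24; 53]; [:: 2; 21; 22; 38]; [:: 2; 23; 31; 56];
      [:: 2; 26; 46; 52]; [:: 2; 29; 32; 36]; [:: 2; 33; 42; 49];
      [:: 2; 40; 47; 55]; [:: 3; 5; 27; 55]; [:: 3; 7; 12; 16];
      [:: 3; 10; 15; 46]; [:: 3; 11; 32; 35]; [:: 3; 13; 34; 45];
      [:: 3; 14; 28; 42]; [:: 3; 18; 39; 56]; [:: 3; 19; 24; 48];
      [:: 3; 20; 40; 57]; [:: 3; 25; 37; 49]; [:: 3; 29; 43; 47];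
      [:: 3; 30; 41; 53]; [:: 3; 38; 44; 51]; [:: 10; 12; 19; 38];
      [:: 10; 13; 21; 44]; [:: 10; 17; 18; 55]; [:: 10; 20; 27; 29];
      [:: 10; 23; 33; 35]; [:: 10; 24; 40; 51]; [:: 10; 26; 36; 56];
      [:: 10; 30; 34; 58]; [:: 10; 31; 47; 54]; [:: 10; 37; 39; 57];
      [:: 11; 13; 25; 52]; [:: 11; 21; 30; 37]; [:: 11; 26; 29; 34];
      [:: 11; 27; 46; 50]; [:: 11; 31; 42; 53]; [:: 11; 43; 45; 56];
      [:: 11; 48; 51; 57]; [:: 18; 22; 26; 30]; [:: 18; 23; 40; 46];
      [:: 18; 28; 47; 50]; [:: 18; 29; 44; 49]; [:: 18; 31; 43; 58];
      [:: 18; 32; 34; 54]; [:: 18; 37; 41; 52]; [:: 19; 26; 33; 57];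
      [:: 19; 30; 32; 43]; [:: 19; 31; 46; 51]; [:: 19; 35; 47; 58];
      [:: 19; 41; 49; 54]; [:: 27; 31; 35; 45]; [:: 34; 43; 44; 53];
      [:: 35; 43; 48; 55]])).
by vm_compute.
Qed.

(** The Frobenius group of order 20: conjugation by the first generator cubes the second, which
    rotates each group of size 5 within itself. *)
Lemma exists_4GDD_2x11_5x8 :
  exists_4GDD_of_type [:: (2, 11); (5, 8)].
Proof.
apply: (exists_4GDD_of_check (bs := develop
  [::
    (4,
     [:: [:: 0; 1]; [:: 2; 4; 6; 8]; [:: 3; 5; 7; 9]; [:: 10; 11];
         [:: 12; 14; 16; 18]; [:: 13; 15; 17; 19]; [:: 20; 21];
         [:: 22; 27; 32; 37]; [:: 23; 28; 33; 38]; [:: 24; 29; 34; 39];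
         [:: 25; 30; 35; 40]; [:: 26; 31; 36; 41]; [:: 42; 47; 52; 57];
         [:: 43; 48; 53; 58]; [:: 44; 49; 54; 59]; [:: 45; 50; 55; 60];
         [:: 46; 51; 56; 61]]);
    (5,
     [:: [:: 0; 2; 9; 5; 6]; [:: 1; 3; 8; 4; 7]; [:: 10; 12; 19; 15; 16];
         [:: 11; 13; 18; 14; 17]; [:: 22; 23; 24; 25; 26];
         [:: 27; 29; 31; 28; 30]; [:: 32; 36; 35; 34; 33];
         [:: 37; 40; 38; 41; 39]; [:: 42; 43; 44; 45; 46];
         [:: 47; 49; 51; 48; 50]; [:: 52; 56; 55; 54; 53];
         [:: 57; 60; 58; 61; 59]])]
  [:: [:: 0; 2; 45; 54]; [:: 0; 3; 25; 59]; [:: 0; 5; 24; 36];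
      [:: 0; 10; 48; 58]; [:: 0; 11; 12; 16]; [:: 0; 13; 38; 51];
      [:: 0; 14; 41; 47]; [:: 0; 15; 27; 52]; [:: 0; 20; 50; 60];
      [:: 0; 21; 23; 33]; [:: 0; 22; 40; 53]; [:: 10; 12; 30; 38];
      [:: 10; 20; 26; 36]; [:: 10; 21; 49; 59]; [:: 10; 23; 42; 61];
      [:: 10; 24; 27; 47]; [:: 10; 29; 50; 53]; [:: 22; 27; 32; 37];
      [:: 22; 29; 51; 54]; [:: 22; 30; 45; 57]; [:: 42; 48; 55; 59]])).
by vm_compute.
Qed.

(** Again the Frobenius group of order 20, now permuting the five groups of size 5 like the affine
    group of the field of five elements. *)
Lemma exists_4GDD_2x20_5x5 :
  exists_4GDD_of_type [:: (2, 20); (5, 5)].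
Proof.
apply: (exists_4GDD_of_check (bs := develop
  [::
    (4,
     [:: [:: 0; 2; 4; 6]; [:: 1; 3; 5; 7]; [:: 8; 10; 12; 14];
         [:: 9; 11; 13; 15]; [:: 16; 18; 20; 22]; [:: 17; 19; 21; 23];
         [:: 24; 26; 28; 30]; [:: 25; 27; 29; 31]; [:: 32; 34; 36; 38];
         [:: 33; 35; 37; 39]; [:: 40; 41]; [:: 45; 50; 55; 60];
         [:: 46; 51; 56; 61]; [:: 47; 52; 57; 62]; [:: 48; 53; 58; 63];
         [:: 49; 54; 59; 64]]);
    (5,
     [:: [:: 0; 8; 16; 24; 32]; [:: 1; 9; 17; 25; 33]; [:: 2; 18; 34; 10; 26];
         [:: 3; 19; 35; 11; 27]; [:: 4; 36; 28; 20; 12];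
         [:: 5; 37; 29; 21; 13]; [:: 6; 30; 14; 38; 22];
         [:: 7; 31; 15; 39; 23]; [:: 40; 45; 61; 51; 55];
         [:: 41; 46; 60; 50; 56]; [:: 42; 47; 62; 52; 57];
         [:: 43; 48; 63; 53; 58]; [:: 44; 49; 64; 54; 59]])]
  [:: [:: 0; 2; 31; 34]; [:: 0; 3; 33; 45]; [:: 0; 4; 11; 15];
      [:: 0; 5; 54; 63]; [:: 0; 7; 9; 47]; [:: 0; 10; 22; 28];
      [:: 0; 12; 48; 53]; [:: 0; 13; 38; 50]; [:: 0; 14; 41; 64];
      [:: 0; 16; 42; 49]; [:: 0; 17; 25; 57]; [:: 0; 19; 46; 51];
      [:: 0; 20; 23; 27]; [:: 0; 35; 58; 61]; [:: 0; 36; 56; 60];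
      [:: 0; 37; 43; 62]; [:: 1; 3; 31; 37]; [:: 1; 13; 49; 54];
      [:: 1; 15; 44; 51]; [:: 1; 17; 45; 63]; [:: 40; 47; 51; 62]])).
by vm_compute.
Qed.

(** A cyclic group of order 7, fixing the last group of size 5 pointwise. *)
Lemma exists_4GDD_2x14_5x8 :
  exists_4GDD_of_type [:: (2, 14); (5, 8)].
Proof.
apply: (exists_4GDD_of_check (bs := develop
  [::
    (7,
     [:: [:: 0; 2; 4; 6; 8; 10; 12]; [:: 1; 3; 5; 7; 9; 11; 13];
         [:: 14; 16; 18; 20; 22; 24; 26]; [:: 15; 17; 19; 21; 23; 25; 27];
         [:: 28; 33; 38; 43; 48; 53; 58]; [:: 29; 34; 39; 44; 49; 54; 59];
         [:: 30; 35; 40; 45; 50; 55; 60]; [:: 31; 36; 41; 46; 51; 56; 61];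
         [:: 32; 37; 42; 47; 52; 57; 62]])]
  [:: [:: 0; 2; 22; 40]; [:: 0; 3; 16; 21]; [:: 0; 4; 44; 57];
      [:: 0; 5; 45; 52]; [:: 0; 6; 13; 51]; [:: 0; 9; 15; 19];
      [:: 0; 11; 53; 62]; [:: 0; 14; 27; 43]; [:: 0; 17; 37; 65];
      [:: 0; 18; 33; 54]; [:: 0; 23; 41; 67]; [:: 0; 24; 32; 38];
      [:: 0; 25; 28; 56]; [:: 0; 26; 59; 63]; [:: 0; 29; 50; 60];
      [:: 0; 30; 49; 64]; [:: 0; 31; 55; 58]; [:: 0; 39; 48; 66];
      [:: 0; 42; 46; 61]; [:: 1; 3; 7; 24]; [:: 1; 15; 30; 39];
      [:: 1; 16; 33; 43]; [:: 1; 17; 29; 49]; [:: 1; 20; 36; 66];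
      [:: 1; 23; 45; 61]; [:: 1; 26; 31; 64]; [:: 1; 27; 38; 44];
      [:: 1; 32; 57; 59]; [:: 1; 34; 58; 67]; [:: 1; 40; 52; 60];
      [:: 1; 41; 50; 55]; [:: 1; 46; 54; 65]; [:: 1; 47; 48; 62];
      [:: 1; 51; 53; 63]; [:: 14; 16; 24; 50]; [:: 14; 17; 32; 39];
      [:: 14; 21; 23; 35]; [:: 14; 25; 37; 54]; [:: 14; 30; 47; 67];
      [:: 14; 31; 52; 61]; [:: 14; 33; 40; 65]; [:: 14; 34; 41; 53];
      [:: 14; 46; 49; 59]; [:: 14; 51; 57; 62]; [:: 15; 21; 51; 61];
      [:: 15; 28; 52; 64]; [:: 15; 33; 45; 53]; [:: 15; 35; 57; 63];
      [:: 15; 37; 40; 66]; [:: 15; 42; 54; 58]; [:: 28; 33; 46; 50];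
      [:: 29; 34; 40; 46]])).
by vm_compute.
Qed.

(** A cyclic group of order 25, regular on the points of the groups of size 5 and fixing the points
    50 and 51. *)
Lemma exists_4GDD_2x26_5x5 :
  exists_4GDD_of_type [:: (2, 26); (5, 5)].
Proof.
apply: (exists_4GDD_of_check (bs := develop
  [::
    (25,
     [:: [:: 0; 2; 4; 6; 8; 10; 12; 14; 16; 18; 20; 22; 24; 26; 28; 30; 32; 34
         ; 36; 38; 40; 42; 44; 46; 48]; [:: 1; 3; 5; 7; 9; 11; 13; 15; 17; 19;
          21; 23; 25; 27; 29; 31; 33; 35; 37; 39; 41; 43; 45; 47; 49]; [:: 52;
          57; 62; 67; 72; 53; 58; 63; 68; 73; 54; 59; 64; 69; 74; 55; 60; 65; 
         70; 75; 56; 61; 66; 71; 76]])]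
  [:: [:: 0; 2; 24; 36]; [:: 0; 3; 57; 71]; [:: 0; 4; 29; 55];
      [:: 0; 5; 47; 53]; [:: 0; 6; 39; 54]; [:: 0; 7; 20; 76];
      [:: 0; 8; 19; 49]; [:: 0; 9; 58; 65]; [:: 0; 10; 27; 62];
      [:: 0; 13; 52; 72]; [:: 0; 15; 59; 75]; [:: 0; 18; 64; 70];
      [:: 0; 21; 35; 45]; [:: 0; 23; 56; 61]; [:: 0; 31; 51; 68];
      [:: 0; 43; 50; 60]; [:: 1; 3; 7; 35]; [:: 1; 13; 53; 65];
      [:: 1; 55; 58; 68]])).
by vm_compute.
Qed.

(** The product of the symmetric group of degree 3 and a cyclic group of order 5: the involution
    conjugates the second generator to its eleventh power, so it inverts the part of order 3 and
    centralizes that of order 5. *)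
Lemma exists_4GDD_2x16_5x9 :
  exists_4GDD_of_type [:: (2, 16); (5, 9)].
Proof.
apply: (exists_4GDD_of_check (bs := develop
  [::
    (2,
     [:: [:: 0; 1]; [:: 2; 4]; [:: 3; 5]; [:: 6; 7]; [:: 8; 10]; [:: 9; 11];
         [:: 12; 13]; [:: 14; 16]; [:: 15; 17]; [:: 18; 19]; [:: 20; 22];
         [:: 21; 23]; [:: 24; 25]; [:: 26; 28]; [:: 27; 29]; [:: 37; 42];
         [:: 38; 43]; [:: 39; 44]; [:: 40; 45]; [:: 41; 46]; [:: 47; 52];
         [:: 48; 53]; [:: 49; 54]; [:: 50; 55]; [:: 51; 56]; [:: 57; 62];
         [:: 58; 63]; [:: 59; 64]; [:: 60; 65]; [:: 61; 66]; [:: 67; 72];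
         [:: 68; 73]; [:: 69; 74]; [:: 70; 75]; [:: 71; 76]]);
    (15,
     [:: [:: 0; 8; 17; 18; 26; 5; 6; 14; 23; 24; 2; 11; 12; 20; 29];
         [:: 1; 9; 16; 19; 27; 4; 7; 15; 22; 25; 3; 10; 13; 21; 28];
         [:: 32; 38; 44; 35; 41; 42; 33; 39; 45; 36; 37; 43; 34; 40; 46];
         [:: 47; 58; 69; 50; 61; 67; 48; 59; 70; 51; 57; 68; 49; 60; 71];
         [:: 52; 73; 64; 55; 76; 62; 53; 74; 65; 56; 72; 63; 54; 75; 66]])]
  [:: [:: 0; 2; 5; 31]; [:: 0; 3; 30; 45]; [:: 0; 4; 61; 76];
      [:: 0; 6; 33; 58]; [:: 0; 7; 26; 38]; [:: 0; 8; 21; 75];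
      [:: 0; 9; 55; 62]; [:: 0; 10; 50; 69]; [:: 0; 12; 46; 65];
      [:: 0; 14; 37; 49]; [:: 0; 17; 36; 56]; [:: 0; 40; 52; 68];
      [:: 0; 41; 43; 72]; [:: 0; 48; 66; 70]; [:: 0; 51; 60; 73];
      [:: 30; 47; 57; 67]; [:: 31; 32; 71; 76]; [:: 32; 37; 50; 75];
      [:: 32; 38; 49; 63]])).
by vm_compute.
Qed.

(** The alternating group of degree 4, regular on the points of the pairs and on the first twelve
    groups of size 5. On the last group only the generator of order 3 acts, by one 3-cycle. *)
Lemma exists_4GDD_2x6_5x13 :
  exists_4GDD_of_type [:: (2, 6); (5, 13)].
Proof.
apply: (exists_4GDD_of_check (bs := develop
  [::
    (2,
     [:: [:: 0; 10]; [:: 1; 11]; [:: 2; 3]; [:: 4; 7]; [:: 5; 6]; [:: 8; 9];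
         [:: 12; 52]; [:: 13; 53]; [:: 14; 54]; [:: 15; 55]; [:: 16; 56];
         [:: 17; 42]; [:: 18; 43]; [:: 19; 44]; [:: 20; 45]; [:: 21; 46];
         [:: 22; 47]; [:: 23; 48]; [:: 24; 49]; [:: 25; 50]; [:: 26; 51];
         [:: 27; 67]; [:: 28; 68]; [:: 29; 69]; [:: 30; 70]; [:: 31; 71];
         [:: 32; 57]; [:: 33; 58]; [:: 34; 59]; [:: 35; 60]; [:: 36; 61];
         [:: 37; 62]; [:: 38; 63]; [:: 39; 64]; [:: 40; 65]; [:: 41; 66]]);
    (2,
     [:: [:: 0; 1]; [:: 2; 8]; [:: 3; 9]; [:: 4; 6]; [:: 5; 7]; [:: 10; 11];
         [:: 12; 27]; [:: 13; 28]; [:: 14; 29]; [:: 15; 30]; [:: 16; 31];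
         [:: 17; 37]; [:: 18; 38]; [:: 19; 39]; [:: 20; 40]; [:: 21; 41];
         [:: 22; 32]; [:: 23; 33]; [:: 24; 34]; [:: 25; 35]; [:: 26; 36];
         [:: 42; 62]; [:: 43; 63]; [:: 44; 64]; [:: 45; 65]; [:: 46; 66];
         [:: 47; 57]; [:: 48; 58]; [:: 49; 59]; [:: 50; 60]; [:: 51; 61];
         [:: 52; 67]; [:: 53; 68]; [:: 54; 69]; [:: 55; 70]; [:: 56; 71]]);
    (3,
     [:: [:: 0; 2; 4]; [:: 1; 3; 5]; [:: 6; 10; 9]; [:: 7; 11; 8];
         [:: 12; 17; 22]; [:: 13; 18; 23]; [:: 14; 19; 24]; [:: 15; 20; 25];
         [:: 16; 21; 26]; [:: 27; 42; 57]; [:: 28; 43; 58]; [:: 29; 44; 59];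
         [:: 30; 45; 60]; [:: 31; 46; 61]; [:: 32; 52; 62]; [:: 33; 53; 63];
         [:: 34; 54; 64]; [:: 35; 55; 65]; [:: 36; 56; 66]; [:: 37; 47; 67];
         [:: 38; 48; 68]; [:: 39; 49; 69]; [:: 40; 50; 70]; [:: 41; 51; 71];
         [:: 72; 73; 74]])]
  [:: [:: 0; 2; 6; 19]; [:: 0; 5; 29; 47]; [:: 0; 10; 25; 50];
      [:: 0; 11; 41; 46]; [:: 0; 12; 38; 51]; [:: 0; 13; 65; 67];
      [:: 0; 15; 21; 61]; [:: 0; 16; 24; 37]; [:: 0; 17; 53; 72];
      [:: 0; 18; 28; 34]; [:: 0; 20; 42; 66]; [:: 0; 22; 35; 56];
      [:: 0; 23; 59; 75]; [:: 0; 26; 44; 60]; [:: 0; 27; 43; 69];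
      [:: 0; 30; 39; 74]; [:: 0; 31; 40; 48]; [:: 0; 32; 70; 76];
      [:: 0; 33; 54; 71]; [:: 0; 36; 62; 73]; [:: 0; 45; 58; 63];
      [:: 0; 55; 57; 68]; [:: 12; 17; 26; 46]; [:: 12; 19; 24; 53];
      [:: 12; 23; 28; 73]; [:: 12; 25; 29; 42]; [:: 12; 27; 47; 57];
      [:: 12; 34; 44; 69]; [:: 12; 35; 50; 67]; [:: 12; 36; 60; 75];
      [:: 12; 43; 58; 70]; [:: 12; 48; 56; 59]; [:: 13; 19; 31; 36];
      [:: 13; 25; 55; 69]; [:: 13; 26; 51; 53]; [:: 13; 28; 56; 71];
      [:: 13; 34; 61; 76]; [:: 13; 40; 45; 68]; [:: 14; 20; 50; 55];
      [:: 14; 26; 40; 56]; [:: 14; 29; 54; 69]; [:: 14; 36; 45; 74];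
      [:: 14; 51; 70; 72]])).
by vm_compute.
Qed.

(** A dihedral group of order 18, acting on the nine groups of size 5 as on the vertices of a
    regular nonagon. *)
Lemma exists_4GDD_2x19_5x9 :
  exists_4GDD_of_type [:: (2, 19); (5, 9)].
Proof.
apply: (exists_4GDD_of_check (bs := develop
  [::
    (2,
     [:: [:: 0; 2]; [:: 1; 3]; [:: 4; 6]; [:: 5; 7]; [:: 8; 10]; [:: 9; 11];
         [:: 12; 14]; [:: 13; 15]; [:: 16; 18]; [:: 17; 19]; [:: 20; 22];
         [:: 21; 23]; [:: 24; 26]; [:: 25; 27]; [:: 28; 30]; [:: 29; 31];
         [:: 32; 34]; [:: 33; 35]; [:: 36; 37]; [:: 43; 48]; [:: 44; 49];
         [:: 45; 50]; [:: 46; 51]; [:: 47; 52]; [:: 53; 58]; [:: 54; 59];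
         [:: 55; 60]; [:: 56; 61]; [:: 57; 62]; [:: 63; 68]; [:: 64; 69];
         [:: 65; 70]; [:: 66; 71]; [:: 67; 72]; [:: 73; 78]; [:: 74; 79];
         [:: 75; 80]; [:: 76; 81]; [:: 77; 82]]);
    (9,
     [:: [:: 0; 4; 8; 12; 16; 20; 24; 28; 32];
         [:: 1; 5; 9; 13; 17; 21; 25; 29; 33];
         [:: 2; 34; 30; 26; 22; 18; 14; 10; 6];
         [:: 3; 35; 31; 27; 23; 19; 15; 11; 7];
         [:: 38; 43; 53; 63; 73; 78; 68; 58; 48];
         [:: 39; 44; 54; 64; 74; 79; 69; 59; 49];
         [:: 40; 45; 55; 65; 75; 80; 70; 60; 50];
         [:: 41; 46; 56; 66; 76; 81; 71; 61; 51];
         [:: 42; 47; 57; 67; 77; 82; 72; 62; 52]])]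
  [:: [:: 0; 2; 5; 7]; [:: 0; 3; 13; 26]; [:: 0; 4; 77; 81];
      [:: 0; 6; 64; 79]; [:: 0; 8; 29; 48]; [:: 0; 9; 20; 74];
      [:: 0; 10; 46; 71]; [:: 0; 11; 37; 66]; [:: 0; 12; 19; 57];
      [:: 0; 14; 39; 69]; [:: 0; 15; 17; 34]; [:: 0; 18; 38; 78];
      [:: 0; 22; 50; 80]; [:: 0; 23; 45; 72]; [:: 0; 27; 54; 65];
      [:: 0; 30; 40; 55]; [:: 0; 33; 51; 53]; [:: 0; 35; 42; 44];
      [:: 0; 36; 58; 70]; [:: 0; 41; 62; 73]; [:: 0; 43; 60; 82];
      [:: 0; 47; 61; 75]; [:: 0; 56; 59; 63]; [:: 1; 3; 77; 82];
      [:: 1; 5; 55; 69]; [:: 1; 7; 57; 72]; [:: 1; 9; 25; 61];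
      [:: 1; 19; 51; 71]; [:: 1; 23; 48; 78]; [:: 1; 27; 50; 75];
      [:: 1; 35; 68; 73]; [:: 1; 37; 42; 59]; [:: 1; 38; 56; 64];
      [:: 1; 49; 58; 80]; [:: 1; 52; 60; 66]; [:: 1; 53; 70; 74];
      [:: 38; 43; 52; 57]; [:: 39; 44; 72; 77]; [:: 39; 56; 66; 79];
      [:: 40; 45; 51; 56]])).
by vm_compute.
Qed.

Theorem theorem4p3 :
  exists_4GDD_of_type [:: (5, 8); (14, 1); (20, 1)] /\
  exists_4GDD_of_type [:: (2, 14); (5, 5)] /\
  exists_4GDD_of_type [:: (2, 4); (5, 9)] /\
  exists_4GDD_of_type [:: (2, 18); (5, 4)] /\
  exists_4GDD_of_type [:: (2, 8); (5, 8)] /\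
  exists_4GDD_of_type [:: (2, 17); (5, 5)] /\
  exists_4GDD_of_type [:: (2, 11); (5, 8)] /\
  exists_4GDD_of_type [:: (2, 20); (5, 5)] /\
  exists_4GDD_of_type [:: (2, 14); (5, 8)] /\
  exists_4GDD_of_type [:: (2, 26); (5, 5)] /\
  exists_4GDD_of_type [:: (2, 16); (5, 9)] /\
  exists_4GDD_of_type [:: (2, 6); (5, 13)] /\
  exists_4GDD_of_type [:: (2, 19); (5, 9)].
Proof.
exact: (conj exists_4GDD_5x8_14x1_20x1
  (conj exists_4GDD_2x14_5x5
  (conj exists_4GDD_2x4_5x9
  (conj exists_4GDD_2x18_5x4
  (conj exists_4GDD_2x8_5x8
  (conj exists_4GDD_2x17_5x5
  (conj exists_4GDD_2x11_5x8
  (conj exists_4GDD_2x20_5x5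
  (conj exists_4GDD_2x14_5x8
  (conj exists_4GDD_2x26_5x5
  (conj exists_4GDD_2x16_5x9
  (conj exists_4GDD_2x6_5x13
  exists_4GDD_2x19_5x9)))))))))))).
Qed.
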